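(* Let $p$ be a prime and let $F$ be an algebraic closure of the finite field $\mathbb{F}_p$. For any integral closed curve $\mathcal{C} \subseteq \mathbb{A}^2_F$ that is neither a vertical nor a horizontal line, there are infinitely many points $(x,y) \in \mathcal{C}(F)$ for which $x$ and $y$ both have the same multiplicative order and such that $x$ and $y$ are $j$-invariants of elliptic curves over $F$ with isomorphic endomorphism rings.
   Context: A vertical (resp. horizontal) line in $\mathbb{A}^2_F$ is a curve of the form $\{c\} \times \mathbb{A}^1_F$ (resp. $\mathbb{A}^1_F \times \{c\}$) with $c \in F$. The multiplicative order of an element of $F^{\ast}$ is its (finite) order in the group $F^{\ast}$; that $x$ and $y$ have the same multiplicative order includes that both are non-zero. Every $x \in F$ is the $j$-invariant of an elliptic curve over $F$, unique up to isomorphism, and endomorphism rings are taken over $F$. *)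

(* Defs.v *)
From HB Require Import structures.
From mathcomp Require Import all_boot all_order all_algebra.
From mathcomp Require Import ring_quotient polyXY mpoly ring.

Set Implicit Arguments.
Unset Strict Implicit.
Unset Printing Implicit Defensive.

Import GRing.Theory.

Local Open Scope ring_scope.

Definition infinitely_many (T : eqType) (A : T -> Prop) : Prop :=
  forall s : seq T, exists2 x, x \notin s & A x.

Definition is_algebraic_closure (K : fieldType) (F : closedFieldType)
    (iota : {rmorphism K -> F}) : Prop :=
  forall x : F, algebraicOver iota x.

(* For elements of a field this forces x and y to be non-zero. *)
Definition same_mul_order (F : fieldType) (x y : F) : Prop :=
  exists n : nat, n.-primitive_root x /\ n.-primitive_root y.

(** * Closed subschemes of the affine plane *)

(* There are primes P <= Q 0 < Q 1 < ... < Q n, i.e. a chain of length n of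
   primes of the quotient by P. *)
Definition has_prime_chain (R : comNzRingType) (P : prime_idealr R) (n : nat)
    : Prop :=
  exists Q : 'I_n.+1 -> prime_idealr R,
    {subset P <= Q ord0} /\
    forall i j : 'I_n.+1, (i < j)%N ->
      {subset Q i <= Q j} /\ ~ {subset Q j <= Q i}.

Definition quotient_krull_dim (R : comNzRingType) (P : prime_idealr R) (n : nat)
    : Prop :=
  has_prime_chain P n /\ forall m, has_prime_chain P m -> (m <= n)%N.

(* The coordinate ring F[x, y] of the affine plane is {poly {poly F}}, where
   x = 'X is the outer and y = 'Y = 'X%:P the inner variable, as in polyXY.
   Integral closed subschemes correspond to prime ideals; prime_idealr asks for
   boolean membership, which classically is no restriction. *)
Record plane_curve (F : fieldType) := PlaneCurve {
  curve_ideal : prime_idealr {poly {poly F}};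
  curve_dim1 : quotient_krull_dim curve_ideal 1
}.

Definition on_plane_curve (F : fieldType) (C : plane_curve F) (x y : F) : Prop :=
  forall f, f \in curve_ideal C -> f.[x, y] = 0.

Definition curve_ideal_generated_by (F : fieldType) (C : plane_curve F)
    (g : {poly {poly F}}) : Prop :=
  forall f, f \in curve_ideal C <-> exists h, f = h * g.

Definition vertical_line (F : fieldType) (C : plane_curve F) : Prop :=
  exists c : F, curve_ideal_generated_by C ('X - c%:P%:P).

Definition horizontal_line (F : fieldType) (C : plane_curve F) : Prop :=
  exists c : F, curve_ideal_generated_by C ('Y - c%:P%:P).

(** * Elliptic curves, in arbitrary characteristic *)

Section Invariants.
Variables (F : fieldType) (a1 a2 a3 a4 a6 : F).

Definition weier_b2 : F := a1 ^+ 2 + 4%:R * a2.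
Definition weier_b4 : F := 2%:R * a4 + a1 * a3.
Definition weier_b6 : F := a3 ^+ 2 + 4%:R * a6.
Definition weier_b8 : F :=
  a1 ^+ 2 * a6 + 4%:R * a2 * a6 - a1 * a3 * a4 + a2 * a3 ^+ 2 - a4 ^+ 2.
Definition weier_c4 : F := weier_b2 ^+ 2 - 24%:R * weier_b4.
Definition weier_disc : F :=
  - weier_b2 ^+ 2 * weier_b8 - 8%:R * weier_b4 ^+ 3 - 27%:R * weier_b6 ^+ 2
  + 9%:R * weier_b2 * weier_b4 * weier_b6.

End Invariants.

Record elliptic_curve (F : fieldType) := EllipticCurve {
  ec_a1 : F; ec_a2 : F; ec_a3 : F; ec_a4 : F; ec_a6 : F;
  ec_smooth : weier_disc ec_a1 ec_a2 ec_a3 ec_a4 ec_a6 != 0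
}.

Definition j_invariant (F : fieldType) (E : elliptic_curve F) : F :=
  weier_c4 (ec_a1 E) (ec_a2 E) (ec_a3 E) (ec_a4 E) ^+ 3
  / weier_disc (ec_a1 E) (ec_a2 E) (ec_a3 E) (ec_a4 E) (ec_a6 E).

Section Points.
Variables (F : fieldType) (E : elliptic_curve F).

Local Notation a1 := (ec_a1 E).
Local Notation a2 := (ec_a2 E).
Local Notation a3 := (ec_a3 E).
Local Notation a4 := (ec_a4 E).
Local Notation a6 := (ec_a6 E).

(* None is the point at infinity. *)
Definition on_ec (P : option (F * F)) : bool :=
  if P is Some (x, y) then
    y ^+ 2 + a1 * x * y + a3 * y == x ^+ 3 + a2 * x ^+ 2 + a4 * x + a6
  else true.

Record ec_point := ECPoint { ec_val :> option (F * F); ec_valP : on_ec ec_val }.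

HB.instance Definition _ := [isSub for ec_val].
HB.instance Definition _ := [Equality of ec_point by <:].

Definition ec_infty : ec_point := ECPoint (erefl (on_ec None)).

(* The slope of the chord through two points with distinct abscissas, or of the
   tangent at the first point otherwise. *)
Definition ec_slope (x1 y1 x2 y2 : F) : F :=
  if x1 == x2
  then (3%:R * x1 ^+ 2 + 2%:R * a2 * x1 + a4 - a1 * y1)
       / (2%:R * y1 + a1 * x1 + a3)
  else (y2 - y1) / (x2 - x1).

Definition ec_add_raw (P Q : option (F * F)) : option (F * F) :=
  match P, Q with
  | None, _ => Q
  | _, None => P
  | Some (x1, y1), Some (x2, y2) =>
    if (x1 == x2) && (y2 == - y1 - a1 * x1 - a3) then None else
    let l := ec_slope x1 y1 x2 y2 in
    let x3 := l ^+ 2 + a1 * l - a2 - x1 - x2 in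
    Some (x3, - (l * (x3 - x1) + y1) - a1 * x3 - a3)
  end.

Lemma ec_add_rawP P Q : on_ec P -> on_ec Q -> on_ec (ec_add_raw P Q).
Proof.
case: P Q => [[x1 y1]|] [[x2 y2]|] //= /eqP h1 /eqP h2.
case: ifPn => //= nopp; apply/eqP; set l := ec_slope _ _ _ _.
set x3 := l ^+ 2 + a1 * l - a2 - x1 - x2.
pose e x y := y ^+ 2 + a1 * x * y + a3 * y
              - (x ^+ 3 + a2 * x ^+ 2 + a4 * x + a6).
have e1 : e x1 y1 = 0 by rewrite /e h1 subrr.
have e2 : e x2 y2 = 0 by rewrite /e h2 subrr.
(* along the line, e is a cubic with roots x1, x2 and x3 *)
pose k := 2%:R * y1 * l + a1 * y1 + a1 * x1 * l + a3 * l
          - (3%:R * x1 ^+ 2 + 2%:R * a2 * x1 + a4).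
pose m := l ^+ 2 + a1 * l - 3%:R * x1 - a2.
have e_line t : e (x1 + t) (y1 + l * t) = e x1 y1 + t * (k + m * t - t ^+ 2).
  by rewrite /e /k /m; ring.
have kE : k + m * (x2 - x1) - (x2 - x1) ^+ 2 = 0.
  case: (eqVneq x1 x2) nopp => [x12 | nx12 _] /=.
    subst x2 => ny; have nz : 2%:R * y1 + a1 * x1 + a3 != 0.
      have: (y1 - y2) * (y2 + y1 + a1 * x1 + a3) = e x1 y1 - e x1 y2.
        by rewrite /e; ring.
      rewrite e1 e2 subrr => /eqP; rewrite mulf_eq0 => /orP[|] /eqP y12.
        apply: contra ny => /eqP h.
        move/subr0_eq: y12 => <-; rewrite -subr_eq0 -h.
        by apply/eqP; ring.
      by case/eqP: ny; rewrite -[LHS]subr0 -y12; ring.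
    by rewrite subrr /k /m /l /ec_slope eqxx; field.
  have nx : x2 - x1 != 0 by rewrite subr_eq0 eq_sym.
  apply: (mulfI nx); rewrite mulr0.
  have := e_line (x2 - x1).
  have -> : l * (x2 - x1) = y2 - y1 by rewrite /l /ec_slope (negPf nx12) divfK.
  have -> : x1 + (x2 - x1) = x2 by ring.
  have -> : y1 + (y2 - y1) = y2 by ring.
  by rewrite e1 e2 add0r => /esym.
have e3 : e x3 (y1 + l * (x3 - x1)) = 0.
  have := e_line (x3 - x1); have -> : x1 + (x3 - x1) = x3 by ring.
  move=> ->; rewrite e1 add0r.
  suff -> : k + m * (x3 - x1) - (x3 - x1) ^+ 2
            = k + m * (x2 - x1) - (x2 - x1) ^+ 2 by rewrite kE mulr0.
  by rewrite /m /x3; ring.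
by apply/eqP; rewrite -subr_eq0 -e3; apply/eqP; rewrite /e; ring.
Qed.

Definition ec_add (P Q : ec_point) : ec_point :=
  ECPoint (ec_add_rawP (ec_valP P) (ec_valP Q)).

(* Homogeneous coordinates (x : y : z) in the projective plane. *)
Definition ec_coord (P : ec_point) (i : 'I_3) : F :=
  match ec_val P with
  | None => [:: 0; 1; 0]`_i
  | Some (x, y) => [:: x; y; 1]`_i
  end.

End Points.

(* f is a morphism of projective curves: around every point it is given by
   homogeneous forms of the same degree without common zero at that point.  By
   separatedness these forms compute f wherever they do not all vanish; the
   scalar l is 0 exactly where they do.  Over an algebraically closed field a
   morphism is determined by its effect on points. *)
Definition ec_morphism (F : closedFieldType) (E E' : elliptic_curve F)
    (f : ec_point E -> ec_point E') : Prop :=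
  forall P : ec_point E, exists (d : nat) (A : 'I_3 -> {mpoly F[3]}),
    [/\ forall i, A i \is d.-homog,
        exists i, (A i).@[ec_coord P] != 0 &
        forall Q, exists l : F, forall i,
          (A i).@[ec_coord Q] = l * ec_coord (f Q) i].

Definition ec_endo (F : closedFieldType) (E : elliptic_curve F)
    (f : ec_point E -> ec_point E) : Prop :=
  ec_morphism f /\ f (ec_infty E) = ec_infty E.

Definition endo_add (F : fieldType) (E : elliptic_curve F)
    (f g : ec_point E -> ec_point E) : ec_point E -> ec_point E :=
  fun P => ec_add (f P) (g P).

(* A ring isomorphism End(E) -> End(E'); addition is pointwise and
   multiplication is composition.  End(E) is the set of f with ec_endo f; it is
   closed under both operations, so the values of Phi outside it are
   irrelevant. *)
Definition endo_ring_isomorphism (F : closedFieldType) (E E' : elliptic_curve F)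
    (Phi : (ec_point E -> ec_point E) -> (ec_point E' -> ec_point E')) : Prop :=
  [/\ forall f, ec_endo f -> ec_endo (Phi f),
      forall f g, ec_endo f -> ec_endo g -> Phi f = Phi g -> f = g,
      forall h, ec_endo h -> exists2 f, ec_endo f & Phi f = h &
      [/\ Phi id = id,
          forall f g, ec_endo f -> ec_endo g ->
            Phi (endo_add f g) = endo_add (Phi f) (Phi g) &
          forall f g, ec_endo f -> ec_endo g -> Phi (f \o g) = Phi f \o Phi g]].

Definition isomorphic_endo_rings (F : closedFieldType) (E E' : elliptic_curve F)
    : Prop :=
  exists Phi, @endo_ring_isomorphism F E E' Phi.

(* Main.v *)
Require Import Defs.
From HB Require Import structures.
From Stdlib Require Import Classical FunctionalExtensionality.
From mathcomp Require Import all_boot all_order all_algebra.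
From mathcomp Require Import ring_quotient polyXY mpoly ring.

(** Write q = p^n and let sigma be the automorphism t |-> t^q of F.  Every point
    of the form (y^q, y) with y algebraic over F_p, y <> 0 has the required
    arithmetic properties: y is a root of unity and sigma preserves
    multiplicative orders, and if E has j-invariant y then the conjugate curve
    E^sigma has j-invariant y^q, while transport along the bijection
    E(F) -> E^sigma(F) identifies the two endomorphism rings.  It therefore
    suffices to show that the graphs x = y^q, for varying n, meet C in
    infinitely many points.

    Let f(x, y) be a nonzero element of the ideal I of C of least degree in x,
    with leading coefficient c(y).  Since C is a curve other than a horizontal
    or vertical line, I contains no x - a and no y - b.  Hence f has positive
    degree in x and, by minimality, no f(a, -) vanishes identically; every g in
    I satisfies c^k g in (f) for some k by pseudo-division, so every zero of f
    with c(y) <> 0 is on C (curve_equation).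

    Consider g(y) = f(y^q, y), whose degree is at least q for large q
    (size_horner_Xn).  At a root b one has y^q - b^q = (y - b)^q, so modulo any
    power of y - b of exponent at most q, g agrees with the nonzero polynomial
    f(b^q, y).  Hence the multiplicities of the roots of g are bounded in terms
    of the degree of f in y, independently of n (Frobenius_graph_multiplicity),
    and for large n the roots of g cannot all lie in a prescribed finite set
    (Frobenius_graph_zero).  That set is taken to contain the second
    coordinates of finitely many given points, the roots of c, and the values 0
    and 1728, at which the uniform family of curves in j_invariant_surj
    degenerates. *)

Set Implicit Arguments.
Unset Strict Implicit.
Unset Printing Implicit Defensive.

Import GRing.Theory.
Local Open Scope ring_scope.

(** * Conjugates of an elliptic curve under a field automorphism *)

Section GaloisConjugate.
Variables (F : fieldType) (sigma : {rmorphism F -> F}).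

(* rmorph_nat comes first: numerals would otherwise be unfolded as sums. *)
Let rmorphE := (rmorph_nat, rmorphXn, rmorphM, rmorphN, rmorphD).

Lemma rmorph_weier_disc a1 a2 a3 a4 a6 :
  sigma (weier_disc a1 a2 a3 a4 a6) =
  weier_disc (sigma a1) (sigma a2) (sigma a3) (sigma a4) (sigma a6).
Proof.
by rewrite /weier_disc /weier_b2 /weier_b4 /weier_b6 /weier_b8 !rmorphE.
Qed.

Lemma rmorph_weier_c4 a1 a2 a3 a4 :
  sigma (weier_c4 a1 a2 a3 a4) =
  weier_c4 (sigma a1) (sigma a2) (sigma a3) (sigma a4).
Proof. by rewrite /weier_c4 /weier_b2 /weier_b4 !rmorphE. Qed.

Variable E : elliptic_curve F.

Lemma ec_conj_smooth :
  weier_disc (sigma (ec_a1 E)) (sigma (ec_a2 E)) (sigma (ec_a3 E))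
             (sigma (ec_a4 E)) (sigma (ec_a6 E)) != 0.
Proof. by rewrite -rmorph_weier_disc fmorph_eq0 ec_smooth. Qed.

Definition ec_conj : elliptic_curve F := EllipticCurve ec_conj_smooth.

Lemma j_invariant_conj : j_invariant ec_conj = sigma (j_invariant E).
Proof.
by rewrite /j_invariant rmorphM rmorphXn fmorphV rmorph_weier_c4
           rmorph_weier_disc.
Qed.

Definition map_coords (P : option (F * F)) : option (F * F) :=
  omap (fun xy => (sigma xy.1, sigma xy.2)) P.

Lemma on_ec_conj P : on_ec ec_conj (map_coords P) = on_ec E P.
Proof.
case: P => [[x y]|] //=.
by rewrite -!(rmorphXn, rmorphM, rmorphD) (inj_eq (fmorph_inj sigma)).
Qed.

Definition conj_point (P : ec_point E) : ec_point ec_conj :=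
  ECPoint (etrans (on_ec_conj (ec_val P)) (ec_valP P)).

Lemma conj_point_infty : conj_point (ec_infty E) = ec_infty ec_conj.
Proof. exact: val_inj. Qed.

Lemma conj_point_add P Q :
  conj_point (ec_add P Q) = ec_add (conj_point P) (conj_point Q).
Proof.
apply: val_inj => /=.
case: (ec_val P) (ec_val Q) => [[x1 y1]|] [[x2 y2]|] //=.
have sl : sigma (ec_slope E x1 y1 x2 y2) =
          ec_slope ec_conj (sigma x1) (sigma y1) (sigma x2) (sigma y2).
  rewrite /ec_slope (inj_eq (fmorph_inj sigma)).
  by case: ifP => _; rewrite fmorph_div !rmorphE.
rewrite -sl -!(rmorphM, rmorphN, rmorphD) !(inj_eq (fmorph_inj sigma)).
by case: ifP => _ //=; rewrite !rmorphE.
Qed.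

Lemma ec_coord_conj P i : ec_coord (conj_point P) i = sigma (ec_coord P i).
Proof.
rewrite /ec_coord /=; case: (ec_val P) => [[x y]|] /=;
  by case: i => [[|[|[|i]]] lti] //=; rewrite ?rmorph0 ?rmorph1.
Qed.

End GaloisConjugate.

(** Going back with conj_point would land on ec_conj tau (ec_conj sigma E), and
    this is E only propositionally; so tau acts directly on the coordinates. *)
Lemma conj_point_bij (F : fieldType) (sigma tau : {rmorphism F -> F})
    (E : elliptic_curve F) :
  cancel tau sigma -> exists2 v, cancel (@conj_point F sigma E) v
                               & cancel v (@conj_point F sigma E).
Proof.
move=> tauK; have sigmaK : cancel sigma tau.
  by move=> x; apply: (fmorph_inj sigma); rewrite tauK.
have mapK : cancel (map_coords tau) (map_coords sigma).
  by case=> [[x y]|] //=; rewrite !tauK.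
have vP (P : ec_point (ec_conj sigma E)) : on_ec E (map_coords tau (ec_val P)).
  by rewrite -(on_ec_conj sigma) mapK ec_valP.
exists (fun P => ECPoint (vP P)) => P; apply: val_inj => /=; last exact: mapK.
by case: (ec_val P) => [[x y]|] //=; rewrite !sigmaK.
Qed.

(** The bijection u need not be a morphism of curves: sigma may move the
    constants.  But if forms A_i define f near v P, then applying sigma to their
    coefficients gives forms of the same degree that define u \o f \o v near
    P. *)
Lemma transport_morphism (F : closedFieldType) (sigma : {rmorphism F -> F})
    (E E' : elliptic_curve F)
    (u : ec_point E -> ec_point E') (v : ec_point E' -> ec_point E) :
    cancel v u ->
    (forall P i, ec_coord (u P) i = sigma (ec_coord P i)) ->
  forall f, ec_morphism f -> ec_morphism (u \o f \o v).
Proof.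
move=> vK uE f mf P; have [d [A [homA [i0 nzA] evA]]] := mf (v P).
have ev i Q : (map_mpoly sigma (A i)).@[ec_coord Q]
              = sigma (A i).@[ec_coord (v Q)].
  rewrite !mevalE rmorph_sum /= (perm_big _ (msupp_map_mpoly _ (fmorph_inj _))).
  apply: eq_bigr => m _; rewrite mcoeff_map_mpoly rmorphM rmorph_prod.
  congr (_ * _); apply: eq_bigr => j _.
  by rewrite -{1}(vK Q) uE rmorphXn.
exists d, (fun i => map_mpoly sigma (A i)); split=> [i||Q].
- apply/dhomogP => m; rewrite (perm_mem (msupp_map_mpoly _ (fmorph_inj _))).
  by move: m; apply/dhomogP.
- by exists i0; rewrite ev fmorph_eq0.
have [l lE] := evA (v Q); exists (sigma l) => i.
by rewrite ev lE rmorphM -uE.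
Qed.

Lemma transport_endo_rings (F : closedFieldType) (E E' : elliptic_curve F)
    (u : ec_point E -> ec_point E') (v : ec_point E' -> ec_point E) :
    cancel u v -> cancel v u ->
    u (ec_infty E) = ec_infty E' -> {morph u : P Q / ec_add P Q} ->
    (forall f, ec_morphism f -> ec_morphism (u \o f \o v)) ->
    (forall f, ec_morphism f -> ec_morphism (v \o f \o u)) ->
  isomorphic_endo_rings E E'.
Proof.
move=> uK vK u0 uD um vm; have v0 : v (ec_infty E') = ec_infty E.
  by rewrite -u0 uK.
exists (fun f => u \o f \o v); split.
- by move=> f [mf f0]; split; [exact: um | rewrite /= v0 f0 u0].
- move=> f g _ _ efg; apply: functional_extensionality => P.
  by have /(congr1 (fun h => v (h (u P)))) := efg; rewrite /= !uK.
- move=> h [mh h0]; exists (v \o h \o u).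
    by split; [exact: vm | rewrite /= u0 h0 v0].
  by apply: functional_extensionality => P /=; rewrite !vK.
split.
- by apply: functional_extensionality => P /=; rewrite vK.
- move=> f g _ _; apply: functional_extensionality => P.
  by rewrite /endo_add /= uD.
- by move=> f g _ _; apply: functional_extensionality => P /=; rewrite uK.
Qed.

(** sigma carries endomorphisms of E to its conjugate, and tau carries them
    back. *)
Lemma endo_ring_conj (F : closedFieldType) (sigma tau : {rmorphism F -> F})
    (E : elliptic_curve F) :
  cancel tau sigma -> isomorphic_endo_rings (ec_conj sigma E) E.
Proof.
move=> tauK; have [v uK vK] := conj_point_bij E tauK.
have uE := ec_coord_conj sigma (E := E).
have vE P i : ec_coord (v P) i = tau (ec_coord P i).
  by apply: (fmorph_inj sigma); rewrite tauK -uE vK.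
apply: (transport_endo_rings (u := v) vK uK).
- by rewrite -(conj_point_infty sigma) uK.
- by move=> P Q; apply: (can_inj uK); rewrite conj_point_add !vK.
- exact: (transport_morphism uK vE).
- exact: (transport_morphism vK uE).
Qed.

(** The curve y^2 + xy = x^3 - 36/(j-1728) x - 1/(j-1728) has c4 = j/(j-1728)
    and discriminant j^2/(j-1728)^3, in every characteristic. *)
Lemma j_invariant_surj (F : fieldType) (j : F) :
  j != 0 -> j != 1728%:R -> exists E : elliptic_curve F, j_invariant E = j.
Proof.
move=> nz0; rewrite -subr_eq0 => nz1; set k := j - _ in nz1.
have jE : j = k + 1728%:R by rewrite subrK.
have dE : weier_disc 1 0 0 (- (36%:R / k)) (- k^-1) = j ^+ 2 / k ^+ 3.
  rewrite /weier_disc /weier_b2 /weier_b4 /weier_b6 /weier_b8 jE.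
  by field.
have cE : weier_c4 1 0 0 (- (36%:R / k)) = j / k.
  by rewrite /weier_c4 /weier_b2 /weier_b4 jE; field.
have sm : weier_disc 1 0 0 (- (36%:R / k)) (- k^-1) != 0.
  by rewrite dE mulf_neq0 ?invr_eq0 ?expf_neq0.
exists (EllipticCurve sm); rewrite /j_invariant /= dE cE.
by field; rewrite nz0 nz1.
Qed.

(** * Powers of Frobenius and roots of unity *)

(** Over an algebraically closed field every element has a q-th root, so the
    q-power map, additive in characteristic p, is bijective. *)
Lemma Frobenius_power_automorphism (F : closedFieldType) (p n : nat) :
  p \in [pchar F] -> exists sigma tau : {rmorphism F -> F},
    cancel tau sigma /\ forall x, sigma x = x ^+ (p ^ n).
Proof.
move=> pF; have p_pr := pcharf_prime pF; pose f (x : F) := x ^+ (p ^ n).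
have q_gt0 : (0 < p ^ n)%N by rewrite expn_gt0 prime_gt0.
have qF : [pchar F].-nat (p ^ n)%N.
  by rewrite pnatX pnatE ?pF.
have fB : zmod_morphism f.
  by move=> x y; apply: (addIr (f y)); rewrite /f -exprDn_pchar // !subrK.
have fM : monoid_morphism f.
  by split; [exact: expr1n | move=> x y; exact: exprMn].
pose sigma : {rmorphism F -> F} :=
  HB.pack f (GRing.isZmodMorphism.Build _ _ f fB)
            (GRing.isMonoidMorphism.Build _ _ f fM).
have root_ex x : exists y, f y == x.
  have [|y] := closed_rootP ('X^(p ^ n) - x%:P) _.
    by rewrite size_XnsubC // eqSS -lt0n.
  by rewrite /root !hornerE subr_eq0 => yx; exists y.
pose g x := xchoose (root_ex x).
have gK : cancel g sigma by move=> x; exact/eqP/(xchooseP (root_ex x)).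
have sigmaK : cancel sigma g.
  by move=> x; apply: (fmorph_inj sigma); rewrite gK.
pose tau : {rmorphism F -> F} :=
  HB.pack g (GRing.isZmodMorphism.Build _ _ g (can2_zmod_morphism sigmaK gK))
            (GRing.isMonoidMorphism.Build _ _ g
               (can2_monoid_morphism sigmaK gK)).
by exists sigma, tau.
Qed.

(** If r is a nonzero polynomial with root z, then z^i only depends on the
    remainder of X^i by r, and over a finite field there are finitely many
    remainders.  So two powers of z coincide. *)
Lemma algebraic_torsion (K : finFieldType) (L : fieldType)
    (iota : {rmorphism K -> L}) (z : L) :
  algebraicOver iota z -> z != 0 -> exists n, n.-primitive_root z.
Proof.
case=> r nz_r rz nz_z; pose d := size r.
pose h (i : 'I_(#|{: 'rV[K]_d}|.+1)) : 'rV[K]_d := poly_rV ('X^i %% r).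
have /injectivePn[i [j nij eij]] : ~~ injectiveb h.
  by apply/injectiveP => /leq_card; rewrite card_ord ltnn.
move: nij eij.
have sz k : (size ('X^k %% r)%R <= d)%N by rewrite ltnW // ltn_modp.
have zE k : z ^+ k = (map_poly iota ('X^k %% r)).[z].
  rewrite -[in LHS](hornerXn z k) -(map_polyXn iota) {1}(divp_eq 'X^k r).
  by rewrite rmorphD rmorphM /= hornerD hornerM (eqP rz) mulr0 add0r.
wlog ltij : i j / (i < j)%N.
  move=> IH nij eij; case: (ltngtP i j) nij => [lt|lt|/val_inj->].
  - by move/(IH i j lt); apply.
  - by rewrite eq_sym; move/(IH j i lt); apply.
  - by rewrite eqxx.
move=> _ /(congr1 (fun v => rVpoly v)); rewrite !poly_rV_K //.
move=> eij; have := zE j; rewrite -eij -zE -(subnK (ltnW ltij)) exprD.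
rewrite -{2}[z ^+ i]mul1r => /(mulIf (expf_neq0 _ nz_z)) zm1.
by have [|n nz _] := prim_order_exists _ zm1; [rewrite subn_gt0 | exists n].
Qed.

(** * Zeros of a plane polynomial on the graph of Frobenius *)

Lemma size_bounded_multiplicity (T : eqType) (s r : seq T) (D : nat) :
  {subset r <= s} -> (forall x, count_mem x r <= D)%N ->
  (size r <= size s * D)%N.
Proof.
elim: s r => [|x s IH] r rs rD.
  by case: r rs rD => [|y r] // /(_ y); rewrite mem_head => /(_ isT).
rewrite -(count_predC (pred1 x)) mulSn leq_add // -size_filter IH //.
  move=> y; rewrite mem_filter /= => /andP[/negPf nyx /rs].
  by rewrite inE nyx.
move=> y; apply: leq_trans (rD y); rewrite count_filter.
by apply: sub_count => z /andP[].
Qed.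

(** If all roots of g were in s, each of multiplicity at most D, then the degree
    of g would be at most size s * D. *)
Lemma root_outside (F : closedFieldType) (g : {poly F}) (s : seq F) (D : nat) :
    (forall b m, (('X - b%:P) ^+ m %| g)%R -> (m <= D)%N) ->
    (size s * D < (size g).-1)%N ->
  exists2 y, y \notin s & root g y.
Proof.
move=> multD; have [r gE] := closed_field_poly_normal g.
have [->|nz_g] := eqVneq g 0; first by rewrite size_poly0.
have nz_l : lead_coef g != 0 by rewrite lead_coef_eq0.
have rg y : y \in r -> root g y.
  by move=> yr; rewrite gE rootZ // root_prod_XsubC.
have -> : (size g).-1 = size r by rewrite gE size_scale // size_prod_XsubC.
move=> lt_s.
case: (boolP (all (fun y => y \in s) r)) => [/allP rs | /allPn[y yr ys]].
  suff : (size r <= size s * D)%N by rewrite leqNgt lt_s.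
  apply: size_bounded_multiplicity rs _ => b; apply: (multD b).
  rewrite gE dvdpZr // (bigID (pred1 b)) /= dvdp_mulr //.
  rewrite (eq_bigr (fun=> 'X - b%:P)) => [|z /eqP -> //].
  rewrite big_const_seq; elim: (count _ _) => [|k IH] //=.
  by rewrite exprS dvdp_mul2l ?polyXsubC_eq0.
by exists y => //; exact: rg.
Qed.

(** One more than the degree of f in the inner variable y, or 0 for f = 0. *)
Definition coef_size (F : fieldType) (f : {poly {poly F}}) : nat :=
  \max_(i < size f) size (f`_i)%R.

Lemma leq_coef_size (F : fieldType) (f : {poly {poly F}}) i :
  (size (f`_i)%R <= coef_size f)%N.
Proof.
have [lt_i|ge_i] := ltnP i (size f); last by rewrite nth_default ?size_poly0.
exact: (leq_bigmax (Ordinal lt_i)).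
Qed.

Lemma size_horner_const (F : fieldType) (f : {poly {poly F}}) (a : F) :
  (size (f.[a%:P])%R <= coef_size f)%N.
Proof.
rewrite horner_coef; apply: leq_trans (size_sum _ _ _) _.
apply/bigmax_leqP => i _; rewrite -polyC_exp mulrC mul_polyC.
exact: leq_trans (size_scale_leq _ _) (leq_coef_size f i).
Qed.

(** As q exceeds the degrees of the coefficients of f, the top term of f
    strictly dominates the others once X^q is substituted for x. *)
Lemma size_horner_Xn (F : fieldType) (f : {poly {poly F}}) (q : nat) :
  (1 < size f)%N -> (coef_size f <= q)%N -> (q < size (f.['X^q])%R)%N.
Proof.
rewrite horner_coef; case Ef: (size f) => [|[|k]] // _ Dq.
have nz_l : f`_k.+1 != 0.
  by rewrite -[k.+1]/(k.+2.-1) -Ef -lead_coefE lead_coef_eq0 -size_poly_eq0 Ef.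
rewrite big_ord_recr /= addrC -exprM.
have szM : size (f`_k.+1 * 'X^(q * k.+1)) = (size (f`_k.+1)%R + q * k.+1)%N.
  by rewrite size_mulXn // addnC.
have l_gt0 : (0 < size (f`_k.+1)%R)%N by rewrite size_poly_gt0.
rewrite size_polyDl szM.
  by rewrite mulnS -[q.+1]add1n leq_add // leq_addr.
apply: leq_trans (_ : (q * k.+1).+1 <= _)%N; last first.
  by rewrite -add1n leq_add2r.
rewrite ltnS; apply: leq_trans (size_sum _ _ _) _; apply/bigmax_leqP => i _.
have [->|nz_i] := eqVneq f`_i 0; first by rewrite mul0r size_poly0.
rewrite -exprM size_mulXn // addnC.
apply: leq_trans (leq_add (leq_trans (leq_coef_size f i) Dq) (leqnn _)) _.
by rewrite -mulnS leq_mul2l ltn_ord orbT.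
Qed.

Lemma dvdp_sub_horner (F : fieldType) (f : {poly {poly F}}) (u v : {poly F}) :
  (u - v %| f.[u] - f.[v])%R.
Proof.
have /factor_theorem[h hE] : root (f - f.[v]%:P) v.
  by rewrite /root hornerD hornerN hornerC subrr.
have := congr1 (fun k => k.[u]) hE; rewrite !hornerE => ->.
exact: dvdp_mull.
Qed.

(** Modulo (X - b)^q the substitutions of X^q and of b^q for x agree, as their
    difference is (X - b)^q.  So a power of X - b of exponent m <= q dividing
    f(X^q, X) divides the nonzero polynomial f(b^q, X).  The bound does not
    depend on n. *)
Lemma Frobenius_graph_multiplicity (F : fieldType) (p n m : nat)
    (f : {poly {poly F}}) (b : F) :
    p \in [pchar F] -> (coef_size f <= p ^ n)%N -> f.[(b ^+ (p ^ n))%:P] != 0 ->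
  (('X - b%:P) ^+ m %| f.['X^(p ^ n)])%R -> (m <= coef_size f)%N.
Proof.
move=> pF Dq nz_f; rewrite leqNgt => dv; apply/negP => lt_m.
set q := (p ^ n)%N in Dq nz_f dv.
(* m itself may exceed q; the exponent coef_size f does not. *)
have {lt_m} dvD : (('X - b%:P) ^+ coef_size f %| f.['X^q])%R.
  by apply: dvdp_trans dv; apply: dvdp_exp2l; exact: ltnW.
have XqB : 'X^q - (b ^+ q)%:P = ('X - b%:P) ^+ q.
  have qF : [pchar {poly F}].-nat q.
    rewrite pnatX pnatE ?(pcharf_prime pF) // pchar_poly.
    by rewrite pF.
  apply: (addIr ((b%:P) ^+ q)).
  by rewrite -exprDn_pchar // subrK -polyC_exp subrK.
have dvc : (('X - b%:P) ^+ coef_size f %| f.[(b ^+ q)%:P])%R.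
  rewrite -(dvdp_subr _ dvD).
  apply: dvdp_trans (dvdp_sub_horner f 'X^q (b ^+ q)%:P).
  by rewrite XqB dvdp_exp2l.
have := dvdp_leq nz_f dvc; rewrite size_exp_XsubC ltnNge.
by rewrite size_horner_const.
Qed.

(** The degree of f(X^(p^n), X) grows with n while the multiplicities of its
    roots stay bounded, so its roots eventually leave any finite set s. *)
Lemma Frobenius_graph_zero (F : closedFieldType) (p : nat)
    (f : {poly {poly F}}) (s : seq F) :
    p \in [pchar F] -> (1 < size f)%N -> (forall a : F, f.[a%:P] != 0) ->
  exists n y, y \notin s /\ f.[y ^+ (p ^ n), y] = 0.
Proof.
move=> pF f_gt1 nz_f; pose n := (coef_size f + size s * coef_size f)%N.
have lt_n : (n < p ^ n)%N by rewrite ltn_expl // prime_gt1 // (pcharf_prime pF).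
have Dq : (coef_size f <= p ^ n)%N.
  by apply: leq_trans (ltnW lt_n); exact: leq_addr.
have [b m||y ys /eqP fy] := @root_outside F f.['X^(p ^ n)] s (coef_size f).
- by apply: (Frobenius_graph_multiplicity pF Dq).
- apply: leq_trans (_ : p ^ n <= _)%N.
    by apply: leq_trans lt_n; rewrite ltnS leq_addl.
  by have := size_horner_Xn f_gt1 Dq; case: (size _).
exists n, y; split=> //; rewrite -fy.
have /dvdpP[h hE] := dvdp_sub_horner f 'X^(p ^ n) (y ^+ (p ^ n))%:P.
have := congr1 (fun k => k.[y]) hE; rewrite !hornerE subrr mulr0.
by move/eqP; rewrite subr_eq0 => /eqP.
Qed.

(** * Equations of a plane curve *)

Section KernelIdeal.
Variables (R : comNzRingType) (S : idomainType) (phi : {rmorphism R -> S}).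

Definition ker_pred : {pred R} := fun x => phi x == 0.

Lemma ker_idealr_closed : idealr_closed ker_pred.
Proof.
split; rewrite ?unfold_in ?rmorph0 ?rmorph1 ?oner_eq0 //.
move=> a u v; rewrite !unfold_in => /eqP u0 /eqP v0.
by rewrite rmorphD rmorphM u0 v0 mulr0 addr0.
Qed.

Lemma ker_prime : prime_idealr_closed ker_pred.
Proof. by move=> u v; rewrite !unfold_in rmorphM mulf_eq0. Qed.

Definition ker_ideal : prime_idealr R :=
  HB.pack ker_pred (isIdealr.Build R ker_pred ker_idealr_closed)
    (isPrimeIdealrClosed.Build R ker_pred ker_prime).

Lemma mem_ker_ideal x : (x \in ker_ideal) = (phi x == 0).
Proof. by []. Qed.

End KernelIdeal.

(** The plane has dimension at least two, by the chain 0 < (x) < (x, y); the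
    last two ideals are the kernels of evaluations. *)
Lemma plane_prime_chain (F : fieldType) (I : prime_idealr {poly {poly F}}) :
  (forall f, f \in I -> f = 0) -> has_prime_chain I 2.
Proof.
move=> I0.
pose ev0 : {rmorphism {poly {poly F}} -> {poly F}} := horner_eval 0.
pose ev00 : {rmorphism {poly {poly F}} -> F} := horner_eval (0 : F) \o ev0.
pose Q (i : 'I_3) : prime_idealr {poly {poly F}} :=
  nth I [:: I; ker_ideal ev0; ker_ideal ev00] i.
have h1 f : f \in ker_ideal ev0 -> f \in ker_ideal ev00.
  by rewrite !mem_ker_ideal /= => /eqP->; rewrite rmorph0.
have X1 : 'X \in ker_ideal ev0.
  by rewrite mem_ker_ideal /ev0 /= /horner_eval hornerX.
have Y2 : 'Y \in ker_ideal ev00.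
  by rewrite mem_ker_ideal /ev00 /ev0 /= /horner_eval hornerC hornerX.
have nX : 'X \notin I.
  by apply/negP => /I0/eqP; rewrite polyX_eq0.
have nY : 'Y \notin ker_ideal ev0.
  by rewrite mem_ker_ideal /ev0 /= /horner_eval hornerC polyX_eq0.
exists Q; split=> // -[[|[|[|i]]] lti] [[|[|[|j]]] ltj] //= _; split=> //.
- by move=> f /I0 ->; exact: (idealr0 (Q (Ordinal ltj))).
- by move/(_ _ X1); apply/negP.
- by move=> f /I0 ->; exact: (idealr0 (Q (Ordinal ltj))).
- by move/(_ _ (h1 _ X1)); apply/negP.
- by move/(_ _ Y2); apply/negP.
Qed.

(** Used for F[x] and F[y] inside F[x, y]: over an algebraically closed field r
    splits into linear factors, and a prime ideal contains one of them. *)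
Lemma prime_ideal_linear_factor (F : closedFieldType) (R : comNzRingType)
    (I : prime_idealr R) (phi : {rmorphism {poly F} -> R}) (r : {poly F}) :
  r != 0 -> phi r \in I -> exists b, phi ('X - b%:P) \in I.
Proof.
move=> nz_r; have [s rE] := closed_field_poly_normal r.
have nz_l : lead_coef r != 0 by rewrite lead_coef_eq0.
have notunit c : c != 0 -> phi c%:P \in I = false.
  move=> nz_c; apply/negP => /(idealMr (phi c^-1%:P)).
  by rewrite -rmorphM -polyCM mulVf // rmorph1 idealr1.
rewrite rE -mul_polyC rmorphM prime_idealrM notunit //=.
elim: s {rE} => [|b s IH]; first by rewrite big_nil rmorph1 idealr1.
by rewrite big_cons rmorphM prime_idealrM => /orP[|/IH //]; exists b.
Qed.

Section PlaneCurve.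
Variables (F : closedFieldType) (C : plane_curve F).
Local Notation I := (curve_ideal C).

Lemma curve_ideal_nonzero : exists2 f, f \in I & f != 0.
Proof.
apply: NNPP => I0; have [_ dim1] := curve_dim1 C.
suff /dim1 : has_prime_chain I 2 by [].
apply: plane_prime_chain => f fI; apply/eqP; case: eqP => // /eqP nz_f.
by case: I0; exists f.
Qed.

(** Otherwise g - g(a, b) is in I for every g, so an ideal containing I is
    either I or contains a nonzero constant, and no chain of length one starts
    at I. *)
Lemma curve_ideal_not_maximal (a b : F) :
  'X - a%:P%:P \in I -> 'Y - b%:P%:P \in I -> False.
Proof.
move=> XI YI; have [[Q [IQ Qlt]] _] := curve_dim1 C.
have [Q01 []] := Qlt ord0 ord_max isT; move=> g gQ1.
have gI : g - g.[a, b]%:P%:P \in I.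
  have /factor_theorem[h hE] : root (g - g.[a%:P]%:P) a%:P.
    by rewrite /root !hornerE subrr.
  have /factor_theorem[k kE] : root (g.[a%:P] - g.[a, b]%:P) b.
    by rewrite /root !hornerE subrr.
  rewrite -[g](subrK g.[a%:P]%:P) -addrA hE; apply: rpredD.
    exact: idealMr.
  rewrite !hornerE subrr mulr0 add0r.
  by rewrite -polyCB kE polyCM polyCB idealMr.
have gab : g.[a, b]%:P%:P \in Q ord_max.
  rewrite -[X in X \in _](subKr g) rpredB //; exact/Q01/IQ.
have [g0|nz] := eqVneq g.[a, b] 0.
  by apply: IQ; rewrite g0 subr0 in gI.
have := idealMr (g.[a, b]^-1)%:P%:P gab.
by rewrite -!polyCM mulVf // idealr1.
Qed.

(** If x - a is in I and f is in I but not divisible by x - a, then f(a, y) is a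
    nonzero element of I, so that some y - b is in I too. *)
Lemma X_notin_curve_ideal (a : F) : ~ vertical_line C -> 'X - a%:P%:P \notin I.
Proof.
move=> nv; apply/negP => XI; apply: nv; exists a => f; split; last first.
  by case=> h ->; exact: idealMr.
move=> fI; suff f0 : root f a%:P by exact/factor_theorem.
apply/negPn/negP => nz_fa.
have faI : f.[a%:P]%:P \in I.
  have /factor_theorem[h hE] : root (f - f.[a%:P]%:P) a%:P.
    by rewrite /root !hornerE subrr.
  by rewrite -[X in X \in _](subKr f) rpredB // hE idealMr.
have [b] := prime_ideal_linear_factor (phi := polyC) nz_fa faI.
by rewrite /= polyCB => /(curve_ideal_not_maximal XI).
Qed.

(** The same argument with the variables exchanged; swapXY makes y the outer
    variable for the division by y - b. *)
Lemma Y_notin_curve_ideal (b : F) :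
  ~ horizontal_line C -> 'Y - b%:P%:P \notin I.
Proof.
move=> nh; apply/negP => YI; apply: nh; exists b => f; split; last first.
  by case=> h ->; exact: idealMr.
move=> fI; pose r := (swapXY f).[b%:P].
have [h fE] : exists h, f = h * ('Y - b%:P%:P) + map_poly polyC r.
  have /factor_theorem[h hE] : root (swapXY f - r%:P) b%:P.
    by rewrite /root !hornerE subrr.
  exists (swapXY h); rewrite -[f]swapXYK -(subrK r%:P (swapXY f)) hE.
  rewrite rmorphD rmorphM rmorphB /= swapXY_X swapXY_polyC.
  by rewrite swapXY_polyC map_polyC.
have [r0|nz_r] := eqVneq r 0.
  by exists h; rewrite fE r0 rmorph0 addr0.
have rI : map_poly polyC r \in I.
  rewrite -(addKr (h * ('Y - b%:P%:P)) (map_poly _ r)) -fE.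
  by rewrite rpredD // rpredN idealMr.
have [a] := prime_ideal_linear_factor (phi := map_poly polyC) nz_r rI.
rewrite rmorphB /= map_polyX map_polyC => XI.
by case: (curve_ideal_not_maximal XI YI).
Qed.

(** Minimality concerns the outer variable x, whose degree size measures. *)
Lemma minimal_curve_equation :
  exists f, [/\ f \in I, f != 0 &
    forall g, g \in I -> (size g < size f)%N -> g = 0].
Proof.
have [f0 f0I nz_f0] := curve_ideal_nonzero.
have [n] := ubnP (size f0); elim: n => // n IH in f0 f0I nz_f0 *.
rewrite ltnS => le_n.
have [[f [fI nz_f lt_f]]|nosmaller] :=
    classic (exists f, [/\ f \in I, f != 0 & (size f < size f0)%N]).
  by apply: (IH f) => //; exact: leq_trans lt_f le_n.
exists f0; split=> // g gI lt_g; apply/eqP; case: eqP => // /eqP nz_g.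
by case: nosmaller; exists g.
Qed.

(** For f of least degree in x, pseudo-dividing g in I by f leaves the remainder
    0, so g vanishes at the zeros of f outside those of the leading coefficient.
    This takes the place of showing that I is principal. *)
Lemma curve_equation (nv : ~ vertical_line C) (nh : ~ horizontal_line C) :
  exists (f : {poly {poly F}}) (c : {poly F}),
    [/\ (1 < size f)%N, forall a : F, f.[a%:P] != 0, c != 0 &
        forall x y, f.[x, y] = 0 -> c.[y] != 0 -> on_plane_curve C x y].
Proof.
have [f [fI nz_f f_min]] := minimal_curve_equation.
exists f, (lead_coef f); split.
(* A polynomial in y alone would put some y - b in I. *)
- rewrite ltnNge; apply/negP => /size1_polyC fE.
  have nz_r : f`_0 != 0 by apply: contra_neq nz_f => r0; rewrite fE r0.
  have rI : (f`_0)%:P \in I by rewrite -fE.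
  have [b] := prime_ideal_linear_factor (phi := polyC) nz_r rI.
  by rewrite /= polyCB; apply/negP; exact: Y_notin_curve_ideal.
(* A factor x - a could be cancelled, as I is prime, against minimality. *)
- move=> a; apply/negP => /factor_theorem[h fE].
  move: fI; rewrite fE prime_idealrM (negPf (X_notin_curve_ideal a nv)) orbF.
  have nz_h : h != 0 by apply: contra_neq nz_f => h0; rewrite fE h0 mul0r.
  move/f_min; rewrite fE size_Mmonic ?monicXsubC // size_XsubC addn2.
  move=> /(_ (leqnn _)) /eqP.
  by rewrite (negPf nz_h).
- by rewrite lead_coef_eq0.
move=> x y fxy nz_c g gI; have := Pdiv.ComRing.rdivp_eq f g.
set k := Pdiv.Ring.rscalp _ _; set q := Pdiv.Ring.rdivp _ _.
set r := Pdiv.Ring.rmodp _ _ => gE.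
have r0 : r = 0.
  apply: f_min; last exact: Pdiv.Ring.ltn_rmodpN0.
  rewrite -[r](addKr (q * f)) -gE rpredD ?rpredN ?idealMr //.
  by rewrite -mul_polyC idealMr.
have := congr1 (fun h => h.[x, y]) gE.
rewrite r0 addr0 hornerZ !hornerM fxy mulr0 horner_exp.
by move/eqP; rewrite mulf_eq0 expf_eq0 (negPf nz_c) andbF => /eqP.
Qed.

End PlaneCurve.

(** * Points with the same order and isomorphic endomorphism rings *)

Theorem proposition5p1 (p : nat) (hp : prime p) (F : closedFieldType)
    (iota : {rmorphism 'F_p -> F}) (hF : is_algebraic_closure iota)
    (C : plane_curve F) (hv : ~ vertical_line C) (hh : ~ horizontal_line C) :
  infinitely_many (fun xy : F * F =>
    [/\ on_plane_curve C xy.1 xy.2,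
        same_mul_order xy.1 xy.2 &
        exists E1 E2 : elliptic_curve F,
          [/\ j_invariant E1 = xy.1, j_invariant E2 = xy.2 &
              isomorphic_endo_rings E1 E2]]).
Proof.
move=> s; have pF : p \in [pchar F] := rmorph_pchar iota (pchar_Fp hp).
have [f [c [f_gt1 nz_f nz_c fC]]] := curve_equation hv hh.
have [rc cE] := closed_field_poly_normal c.
have [n [y [ys fy]]] := Frobenius_graph_zero
  ([:: 0; 1728%:R] ++ map snd s ++ rc) pF f_gt1 nz_f.
move: ys; rewrite !(inE, mem_cat) !negb_or => /and4P[y0 y1728 ys yc].
have [sigma [tau [tauK sigmaE]]] := Frobenius_power_automorphism n pF.
have [m ord_y] := algebraic_torsion (hF y) y0.
have [E jE] := j_invariant_surj y0 y1728.
exists (y ^+ (p ^ n), y); first by apply: contra ys => /(map_f snd).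
rewrite -sigmaE; split => /=.
- rewrite sigmaE; apply: fC => //; apply: contra yc => cy.
  move: cy; rewrite cE hornerZ mulf_eq0 lead_coef_eq0 (negPf nz_c) /=.
  by rewrite -[_ == 0]/(root _ _) root_prod_XsubC.
- by exists m; rewrite fmorph_primitive_root.
by exists (ec_conj sigma E), E; split;
  [rewrite j_invariant_conj jE | | exact: endo_ring_conj tauK].
Qed.
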